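(* Let $\mu_0\in\mathcal M$, let $(\mu_n)_{n\in\mathbb N}$ be a sequence in $\mathcal M$ and let $p\in(0,\infty)$. If $\mathrm{w}^*\text{-}\lim\mu_n=\mu_0$, then $$\limsup_{n\to\infty} d_p(\mu_n;S)\le d_p(\mu_0;S)$$ for every non-empty subset $S\subseteq G\setminus\{0\}$.
   Context: $G$ is a locally compact abelian Hausdorff group (written additively), $\Gamma$ is its dual group, and for $x\in G$, $e_x:\Gamma\to\mathbb C$ denotes the character of $\Gamma$ generated by $x$. $\mathcal M$ is the set of all non-zero finite non-negative regular Borel measures on $\Gamma$. For a non-empty set $S\subseteq G\setminus\{0\}$, $\mathcal T(S)$ is the complex linear space of all finite sums $\sum_j a_je_{x_j}$ with $a_j\in\mathbb C$, $x_j\in S$. For $\mu\in\mathcal M$ and $p\in(0,\infty)$, $d_p(\mu;S):=\inf\{\int|1-\tau|^p\,d\mu:\tau\in\mathcal T(S)\}$. $\mathrm{w}^*\text{-}\lim\mu_n=\mu_0$ means that $\lim_{n}\int f\,d\mu_n=\int f\,d\mu_0$ for every bounded continuous function $f:\Gamma\to\mathbb C$. *)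

(* Defs.v *)
From HB Require Import structures.
From mathcomp Require Import all_boot all_order all_algebra.
From mathcomp Require Import complex.
From mathcomp Require Import all_classical all_reals all_analysis.

Set Implicit Arguments.
Unset Strict Implicit.
Unset Printing Implicit Defensive.

Import Order.TTheory GRing.Theory Num.Theory.
Import numFieldNormedType.Exports.

Local Open Scope classical_set_scope.
Local Open Scope complex_scope.
Local Open Scope ring_scope.

(* The topology and norm of a concrete numFieldType such as [R[i]] are
   canonically attached to its regular module. *)
Notation Cplx R := (R[i]^o).

Section dual_group.
Variables (R : realType) (G : topologicalZmodType).

(* Together with [`|f x| = 1], multiplicativity says that [f] is a homomorphism
   into the circle group. *)
Definition is_character (f : G -> Cplx R) : Prop :=
  [/\ continuous f, forall x, `|f x| = 1 & forall x y, f (x + y) = f x * f y].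

(* As a subtype of the compact-open function space, [dual] carries the topology
   of uniform convergence on compact sets. *)
Definition dual : Type :=
  [set f : {compact-open, G -> Cplx R} | is_character f].

HB.instance Definition _ := Topological.on dual.

(* [eval_char x] is the character $e_x$ of the dual group. *)
Definition eval_char (x : G) (g : dual) : Cplx R := \val g x.

Lemma is_character_val (g : dual) : is_character (\val g).
Proof. exact: set_valP. Qed.

Definition mk_dual (f : {compact-open, G -> Cplx R}) (hf : is_character f) :
  dual := SigSub (mem_set hf).

Fact char0_subproof : is_character (fun=> 1).
Proof.
split=> [x|x|x y]; [exact: cvg_cst|exact: normr1|by rewrite mulr1].
Qed.

Fact charN_subproof (g : dual) : is_character (fun x => (\val g x)^-1).
Proof.
have [gc g1 gD] := is_character_val g.
split=> [x|x|x y]; last by rewrite gD invfM.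
  apply: (@cvgV _ _ _ (nbhs_filter x) (\val g)); last exact: gc.
  by rewrite -normr_gt0 g1 ltr01.
by rewrite normfV g1 invr1.
Qed.

Fact charD_subproof (g h : dual) : is_character (fun x => \val g x * \val h x).
Proof.
have [gc g1 gD] := is_character_val g; have [hc h1 hD] := is_character_val h.
split=> [x|x|x y]; last by rewrite gD hD mulrACA.
  by apply: (@cvgM _ _ _ (nbhs_filter x) (\val g) (\val h)); [exact: gc|exact: hc].
by rewrite normrM g1 h1 mulr1.
Qed.

Definition dual_zero : dual := mk_dual char0_subproof.
Definition dual_opp (g : dual) : dual := mk_dual (charN_subproof g).
Definition dual_add (g h : dual) : dual := mk_dual (charD_subproof g h).

Fact dualP (g h : dual) : (forall x, \val g x = \val h x) -> g = h.
Proof. by move=> gh; apply/val_inj/funext. Qed.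

Fact dual_addA : associative dual_add.
Proof. by move=> f g h; apply: dualP => x /=; rewrite mulrA. Qed.

Fact dual_addC : commutative dual_add.
Proof. by move=> f g; apply: dualP => x /=; rewrite mulrC. Qed.

Fact dual_add0 : left_id dual_zero dual_add.
Proof. by move=> f; apply: dualP => x /=; rewrite mul1r. Qed.

Fact dual_addN : left_inverse dual_zero dual_opp dual_add.
Proof.
move=> g; apply: dualP => x /=; rewrite mulVf//.
have [_ g1 _] := is_character_val g.
by rewrite -normr_gt0 g1 ltr01.
Qed.

(* The dual group is written additively; its law is the pointwise product. *)
HB.instance Definition _ :=
  GRing.isZmodule.Build dual dual_addA dual_addC dual_add0 dual_addN.

HB.instance Definition _ := isPointed.Build dual 0.

Lemma eval_charD (x : G) (g h : dual) :
  eval_char x (g + h) = eval_char x g * eval_char x h.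
Proof. by []. Qed.

Definition borel_dual := g_sigma_algebraType (@open dual).

End dual_group.

Section measures.
Variables (R : realType) (G : topologicalZmodType).
Local Notation Gamma := (dual R G).
Local Notation B := (borel_dual R G).
Local Open Scope ereal_scope.

Definition regular_measure (mu : {finite_measure set B -> \bar R}) : Prop :=
  forall A : set B, measurable A ->
    mu A = ereal_inf [set mu U | U in [set U : set Gamma | open U /\ A `<=` U]]
    /\
    mu A = ereal_sup [set mu K | K in [set K : set Gamma | compact K /\ K `<=` A]].

Definition class_M (mu : {finite_measure set B -> \bar R}) : Prop :=
  mu setT != 0 /\ regular_measure mu.

Definition trig_poly (S : set G) : set (Gamma -> Cplx R) :=
  [set tau | exists (m : nat) (a : 'I_m -> Cplx R) (x : 'I_m -> G),
    (forall j, S (x j)) /\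
    tau = (fun g => (\sum_(j < m) a j * eval_char (x j) g)%R)].

Definition d_p (p : R) (mu : {finite_measure set B -> \bar R}) (S : set G) :
    \bar R :=
  ereal_inf [set \int[mu]_g (ComplexField.Normc.normc (1 - tau g) `^ p)%:E
            | tau in trig_poly S].

Definition cintegral (mu : {finite_measure set B -> \bar R})
    (f : Gamma -> Cplx R) : Cplx R :=
  ((\int[mu]_g complex.Re (f g)) +i* (\int[mu]_g complex.Im (f g)))%R.

Definition wstar_cvg (mu : nat -> {finite_measure set B -> \bar R})
    (mu0 : {finite_measure set B -> \bar R}) : Prop :=
  forall f : Gamma -> Cplx R, continuous f -> bounded_fun f ->
    cintegral (mu n) f @[n --> \oo] --> cintegral mu0 f.

End measures.

(* Main.v *)
Require Import Defs.
From HB Require Import structures.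
From mathcomp Require Import all_boot all_order all_algebra.
From mathcomp Require Import complex.
From mathcomp Require Import all_classical all_reals all_analysis.

Set Implicit Arguments.
Unset Strict Implicit.
Unset Printing Implicit Defensive.

Import Order.TTheory GRing.Theory Num.Theory.
Import numFieldNormedType.Exports.

Local Open Scope classical_set_scope.
Local Open Scope ring_scope.

(** An infimum of continuous functions is upper semicontinuous, and here each
    function under the infimum is weak-* continuous.  Fix tau in T(S).  The
    characters e_x are continuous of modulus 1 on the dual group, so the
    trigonometric polynomial tau, and with it h = |1 - tau|^p, is continuous
    and bounded ([continuous_trig_poly], [bounded_trig_poly],
    [continuous_normc_powR]).  Hence h is an admissible test function for
    weak-* convergence, and the integrals of h against mu_n tend to its
    integral against mu_0 ([wstar_cvg_integral]).  As d_p(mu_n; S) is at most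
    the former for every n, limsup d_p(mu_n; S) is at most the integral of
    |1 - tau|^p against mu_0; it remains to take the infimum over tau.

    Weak-* convergence speaks of complex integrals, converging in R[i], while
    d_p is defined by extended real ones.  To pass from the former to the
    latter it suffices that real part and modulus are 1-Lipschitz maps from
    R[i] to R, and that h is integrable for every finite measure. *)

Section complex_limits.
Variable R : realType.
Local Open Scope complex_scope.
Local Notation normc := ComplexField.Normc.normc.

(** The norm of R[i] takes its values in R[i] itself, whereas d_p uses the
    real-valued modulus [normc]; this conversion is used throughout. *)
Lemma normCE (z : Cplx R) : `|z| = (normc z)%:C.
Proof. by []. Qed.

(** Stated for a general 1-Lipschitz map because both the real part (for the
    integrals) and the modulus (for the integrand) are needed. *)
Lemma cvg_nonexpansive (T : Type) (F : set_system T) {FF : Filter F}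
    (phi : Cplx R -> R) (u : T -> Cplx R) (l : Cplx R) :
  (forall z w, `|phi z - phi w| <= normc (z - w)) ->
  u @ F --> l -> phi (u t) @[t --> F] --> phi l.
Proof.
move=> philip /cvgrPdist_lt ul; apply/cvgrPdist_lt => e e0.
have eC : 0 < e%:C :> R[i] by rewrite ltcR.
near=> t; apply: le_lt_trans (philip _ _) _.
by rewrite -ltcR -normCE; near: t; exact: ul.
Unshelve. all: by end_near. Qed.

Lemma Re_nonexpansive (z w : Cplx R) :
  `|complex.Re z - complex.Re w| <= normc (z - w).
Proof.
rewrite -lecR -normCE.
have -> : complex.Re z - complex.Re w = complex.Re (z - w).
  by case: z w => [a b] [c d].
exact: normc_ge_Re.
Qed.

Lemma normc_nonexpansive (z w : Cplx R) : `|normc z - normc w| <= normc (z - w).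
Proof.
have H (a b : Cplx R) : normc a - normc b <= normc (a - b).
  by rewrite lerBlDr -[in leLHS](subrK b a) -lecR rmorphD /= -!normCE ler_normD.
have NB : normc (w - z) = normc (z - w).
  by have /eqP := distrC w z; rewrite !normCE => /eqP [].
by rewrite ler_norml H andbT lerNl opprB -NB H.
Qed.

Lemma cvg_real_complex (T : Type) (F : set_system T) {FF : Filter F}
    (u : T -> R) (l : R) :
  u @ F --> l -> ((u t)%:C : Cplx R) @[t --> F] --> (l%:C : Cplx R).
Proof.
move=> /cvgrPdist_lt ul; apply/cvgrPdist_lt => -[e e'].
rewrite ltcE /= => /andP[/eqP -> e0]; near=> t.
have -> : (l%:C - (u t)%:C : Cplx R) = (l - u t)%:C by rewrite rmorphB.
rewrite normCE /normc /= expr0n addr0 sqrtr_sqr ltcR.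
by near: t; exact: ul.
Unshelve. all: by end_near. Qed.

(** The absolute value matters: on the negative axis [powR] is constantly 1, so
    x |-> x `^ p itself jumps at 0. *)
Lemma continuous_norm_powR (p : R) : 0 < p -> continuous (fun x : R => `|x| `^ p).
Proof.
move=> p0 x; have [->|x0] := eqVneq x 0.
  apply/cvgrPdist_lt => e e0.
  rewrite normr0 powR0 ?gt_eqF//.
  near=> y; rewrite sub0r normrN ger0_norm ?powR_ge0//.
  (* |y| `^ p < e amounts to |y| < e `^ p^-1 by monotonicity of powR. *)
  have -> : e = (e `^ p^-1) `^ p.
    by rewrite -powRrM mulVf ?gt_eqF// powRr1// ltW.
  rewrite gt0_ltr_powR ?nnegrE ?powR_ge0//.
  near: y; apply: (@nbhs0_lt _ R); exact: powR_gt0.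
apply: (@continuous_comp _ _ _ (fun x : R => `|x|) (fun y => y `^ p)).
  exact: norm_continuous.
apply: differentiable_continuous; apply/derivable1_diffP.
by apply: derivable_powR; rewrite in_itv/= andbT normr_gt0.
Unshelve. all: by end_near. Qed.

Lemma normc_ge0 (z : Cplx R) : 0 <= normc z.
Proof. by rewrite -lecR -normCE normr_ge0. Qed.

Lemma continuous_normc_powR (T : topologicalType) (f : T -> Cplx R) (p : R) :
  0 < p -> continuous f -> continuous (fun t => normc (f t) `^ p).
Proof.
move=> p0 cf.
have -> : (fun t => normc (f t) `^ p) =
    (fun x : R => `|x| `^ p) \o (fun t => normc (f t)).
  by apply/funext => t /=; rewrite ger0_norm ?normc_ge0.
move=> t; apply: continuous_comp; last exact: continuous_norm_powR.
by apply: cvg_nonexpansive; [exact: normc_nonexpansive|exact: cf].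
Qed.

End complex_limits.

Section dual_functions.
Variables (R : realType) (G : topologicalZmodType).
Local Notation Gamma := (dual R G).
Local Notation B := (borel_dual R G).
Local Notation normc := ComplexField.Normc.normc.

(** Points are compact, so the functions sending x into an open set O form a
    subbasic open set of the compact-open topology. *)
Lemma continuous_eval_char (x : G) :
  continuous (eval_char x : Gamma -> Cplx R).
Proof.
apply/continuousP => O oO.
have -> : eval_char x @^-1` O =
    set_val @^-1` [set f : {compact-open, G -> Cplx R} | f @` [set x] `<=` O].
  apply/seteqP; split => [g /= gO _ [_ -> <-]|g /= gO]; first exact: gO.
  by apply: gO; exists x.
apply: open_comp; last by apply: compact_open_open => //; exact: compact_set1.
by move=> g _; exact: initial_continuous.
Qed.

Lemma norm_eval_char (x : G) (g : Gamma) : `|eval_char x g| = 1.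
Proof. by have [_ g1 _] := is_character_val g; exact: g1. Qed.

Lemma continuous_trig_poly (S : set G) (tau : Gamma -> Cplx R) :
  trig_poly S tau -> continuous tau.
Proof.
move=> [m [a [x [_ ->]]]].
apply: (@continuous_big (Cplx R)) => [|j _ g]; first exact: add_continuous.
by apply: (@cvgM _ _ _ (nbhs_filter g)); [exact: cvg_cst|exact: continuous_eval_char].
Qed.

Lemma bounded_trig_poly (S : set G) (tau : Gamma -> Cplx R) :
  trig_poly S tau -> exists M : R, forall g, normc (tau g) <= M.
Proof.
move=> [m [a [x [_ ->]]]]; exists (\sum_(j < m) normc (a j)) => g.
rewrite -lecR -normCE rmorph_sum /=; apply: le_trans (ler_norm_sum _ _ _) _.
by apply: ler_sum => j _; rewrite normrM norm_eval_char mulr1 normCE.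
Qed.

(** The Borel sets of the dual group are generated by its open sets, so it is
    enough to look at preimages of open intervals. *)
Lemma continuous_measurable_dual (h : Gamma -> R) :
  continuous h -> measurable_fun [set: B] (h : B -> R).
Proof.
move=> /continuousP ch; apply: (measurability _ (measurable_realfun.RGenOpens.measurableE R)).
move=> _ [_ [a [b ->] <-]]; rewrite setTI; apply: sub_sigma_algebra.
exact/ch/interval_open.
Qed.

(** Boundedness of h is used twice: to make h%:C a test function, and to make
    its integrals finite, since the real integral occurring in [cintegral] is
    the extended one truncated by [fine]. *)
Lemma wstar_cvg_integral (mu : nat -> {finite_measure set B -> \bar R})
    (mu0 : {finite_measure set B -> \bar R}) (h : Gamma -> R) (M : R) :
  wstar_cvg mu mu0 -> continuous h -> (forall g, `|h g| <= M) ->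
  (\int[mu n]_g (h g)%:E)%E @[n --> \oo] --> (\int[mu0]_g (h g)%:E)%E.
Proof.
move=> mucvg ch hM.
have hfin (nu : {finite_measure set B -> \bar R}) :
    (\int[nu]_g (h g)%:E)%E \is a fin_num.
  apply: integrable_fin_num => //; apply: measurable_bounded_integrable => //.
  - by rewrite ltey_eq fin_num_measure.
  - exact: continuous_measurable_dual.
  - exists M; split=> [|x Mx g _ /=]; first exact: num_real.
    exact: le_trans (hM g) (ltW Mx).
have intE (nu : {finite_measure set B -> \bar R}) :
    (\int[nu]_g (h g)%:E)%E =
    (complex.Re (cintegral nu (fun g => (h g)%:C%C)))%:E.
  exact: esym (fineK (hfin nu)).
rewrite intE; under eq_fun do rewrite intE.
apply: continuous_cvg => //.
apply: cvg_nonexpansive; first exact: Re_nonexpansive.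
apply: mucvg => [g|]; first by apply: (@cvg_real_complex _ _ _ (nbhs_filter g)); exact: ch.
exists M%:C%C; split=> [|x Mx g _ /=]; first by rewrite complex_real.
apply: le_trans (ltW Mx).
by rewrite normCE /normc /= expr0n addr0 sqrtr_sqr lecR.
Qed.

End dual_functions.

Lemma le_limn_esup (R : realType) (u v : nat -> \bar R) :
  (forall n, u n <= v n)%E -> (limn_esup u <= limn_esup v)%E.
Proof.
move=> uv; apply: le_ereal_inf_tmp => _ [A FA <-].
apply: ge_ereal_inf; exists (ereal_sup (u @` A)); first by exists A.
apply: ge_ereal_sup => _ [n An <-]; apply: le_trans (uv n) _.
by apply: ereal_sup_ubound; exists n.
Qed.

Theorem theorem3p1 (R : realType) (G : topologicalZmodType)
    (hausdorffG : hausdorff_space G) (lcG : locally_compact [set: G])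
    (mu0 : {finite_measure set (borel_dual R G) -> \bar R})
    (mu : nat -> {finite_measure set (borel_dual R G) -> \bar R})
    (p : R) :
  class_M mu0 -> (forall n, class_M (mu n)) -> 0 < p ->
  wstar_cvg mu mu0 ->
  forall S : set G, S !=set0 -> S `<=` [set~ 0] ->
    (limn_esup (fun n => d_p p (mu n) S) <= d_p p mu0 S)%E.
Proof.
move=> _ _ p0 mucvg S _ _; apply: le_ereal_inf_tmp => _ [tau Stau <-].
set h := fun g => ComplexField.Normc.normc (1 - tau g) `^ p.
have ch : continuous h.
  apply: continuous_normc_powR => // g.
  apply: (@cvgB _ _ _ _ (nbhs_filter g)); first exact: cvg_cst.
  exact: continuous_trig_poly Stau g.
have [M tauM] := bounded_trig_poly Stau.
have le_norm g : ComplexField.Normc.normc (1 - tau g) <= 1 + M.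
  apply: le_trans (_ : 1 + ComplexField.Normc.normc (tau g) <= _).
    rewrite -lecR rmorphD /= -!normCE.
    by have := ler_normB (1 : Cplx R) (tau g); rewrite normr1.
  by rewrite lerD2l.
have hM g : `|h g| <= (1 + M) `^ p.
  rewrite ger0_norm ?powR_ge0//; apply: ge0_ler_powR; rewrite ?nnegrE ?normc_ge0//.
    exact: ltW.
  exact: le_trans (normc_ge0 _) (le_norm g).
have [_ <-] := cvg_limn_einf_sup (wstar_cvg_integral mucvg ch hM).
apply: le_limn_esup => n; apply: ereal_inf_lbound; by exists tau.
Qed.
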